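(* Let $n\ge 2$ be an integer, $\sigma\ge 0$, and let $F:\mathbb{C}\to\mathbb{C}$ be locally Lipschitz with $F(z)=\mathcal{O}(|z|^{n-1})$ as $|z|\to\infty$. Let $\phi$ be the local stochastic flow on $\mathbb{R}^2\cong\mathbb{C}$ associated to the SDE $$\mathrm{d}Z_t=\left(Z_t^n+F(Z_t)\right)\mathrm{d}t+\sigma\,\mathrm{d}B_t,$$ where $B=W^{(1)}+iW^{(2)}$ is a complex Brownian motion, and write $\phi_t=\phi_{0,t}$ and $\phi_t^{(1)}$ for its first component. Then there is almost sure blow-up: there exists $T\in(0,\infty)$ such that $$\mathbb{P}\left(\exists\, z\in\mathbb{R}^2:\ \sup_{t\le T}\phi_t^{(1)}(z)=\infty\right)=1.$$
   Context: Complex Brownian motion means $B=W^{(1)}+iW^{(2)}$ with $W^{(1)},W^{(2)}$ independent standard real Brownian motions started at $0$ on a filtered probability space $(\Omega,\mathcal{F},(\mathcal{F}_t),\mathbb{P})$ satisfying the usual conditions. $\mathbb{C}$ is identified with $\mathbb{R}^2$ via $z=x+iy\leftrightarrow(x,y)$. Local stochastic flow on $\mathbb{R}^d$: let $\mathfrak{e}(s,x)$, $s\ge0$, $x\in\mathbb{R}^d$, be a random field with values in $(s,\infty]$ which is lower semicontinuous in $s$ and $x$, and set $\mathbb{D}_{s,t}(\omega)=\{x\in\mathbb{R}^d:\mathfrak{e}(s,x,\omega)>t\}$. Let $\phi_{s,t}(x,\omega)$, $x\in\mathbb{R}^d$, $0\le s\le t<\mathfrak{e}(s,x)$, be a continuous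 $\mathbb{R}^d$-valued random field defined on the random domain of those $(s,t,x)$ with $x\in\mathbb{D}_{s,t}(\omega)$, and let $\mathbb{R}_{s,t}(\omega)$ be the range of $\phi_{s,t}(\cdot,\omega)$ on $\mathbb{D}_{s,t}(\omega)$. $\phi$ is a local stochastic flow if for almost all $\omega$: (i) $\phi_{s,s}(\cdot,\omega)=\mathrm{Id}$ for all $s\ge0$; (ii) $\phi_{s,t}(\cdot,\omega):\mathbb{D}_{s,t}(\omega)\to\mathbb{R}_{s,t}(\omega)$ is a homeomorphism for all $0\le s<t$ and the inverse is continuous in $(s,t,x)$; (iii) $\phi_{s,u}(\cdot,\omega)=\phi_{t,u}(\phi_{s,t}(\cdot,\omega),\omega)$ on $\mathbb{D}_{s,u}(\omega)$ for all $0\le s\le t\le u$. The local stochastic flow associated to the SDE is the one (known to exist) for which $t\mapsto\phi_{s,t}(x)$ is the maximal solution of the SDE starting at time $s$ in $x\in\mathbb{R}^2$, with $\mathfrak{e}(s,x)$ its explosion time. The supremum over $t\le T$ of $\phi_t^{(1)}(z)$ is taken over those $t\in[0,T]$ with $t<\mathfrak{e}(0,z)$. *)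

(* Defs.v *)
From HB Require Import structures.
From mathcomp Require Import all_boot all_order all_algebra.
From mathcomp Require Import complex.
From mathcomp Require Import all_classical all_reals all_analysis measurable_realfun.

Set Implicit Arguments.
Unset Strict Implicit.
Unset Printing Implicit Defensive.

Import Order.TTheory GRing.Theory Num.Theory.
Import numFieldNormedType.Exports.

Local Open Scope classical_set_scope.
Local Open Scope ring_scope.
Local Open Scope complex_scope.

Definition toC (R : realType) (z : R * R) : R[i] := z.1 +i* z.2.

Definition ofC (R : realType) (c : R[i]) : R * R :=
  let: x +i* y := c in (x, y).

(* [R[i]^o] is [R[i]] seen as a normed space over itself; its norm is the
   modulus. *)
Definition locally_lipschitz (R : realType) (F : R[i] -> R[i]) : Prop :=
  forall c : R[i]^o, exists2 A : set R[i]^o,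
    nbhs c A & lipschitz_on (F : R[i]^o -> R[i]^o) (globally (A `*` A)).

(* [F z = O(|z|^k)] as [|z| -> oo]. The modulus is [R[i]]-valued, so the real
   constants are embedded in [R[i]]. *)
Definition bigO_infty (R : realType) (F : R[i] -> R[i]) (k : nat) : Prop :=
  exists C M : R, forall z : R[i],
    M%:C <= `|z| -> `|F z| <= C%:C * `|z| ^+ k.

Section probability_space.
Context (R : realType) (d : measure_display) (Omega : measurableType d).
Variable P : probability Omega R.

Definition independent (G H : set (set Omega)) : Prop :=
  forall A B, G A -> H B -> P (A `&` B) = (P A * P B)%E.

(* Time is [R], of which only [t >= 0] is meaningful. *)
Record filtration_usual (Ft : R -> set (set Omega)) : Prop := {
  filtration_sigma_algebra : forall t : R, 0 <= t -> sigma_algebra setT (Ft t);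
  filtration_measurable : forall t : R, 0 <= t -> Ft t `<=` measurable;
  filtration_nondecreasing :
    forall s t : R, 0 <= s -> s <= t -> Ft s `<=` Ft t;
  filtration_complete : measure_is_complete P;
  filtration_negligible : P.-negligible `<=` Ft 0;
  filtration_right_continuous :
    forall t : R, 0 <= t -> \bigcap_(u in [set u | t < u]) Ft u = Ft t }.

Definition process_sigma_algebra (W : R -> Omega -> R) : set (set Omega) :=
  <<s \bigcup_(t in [set t : R | 0 <= t])
        preimage_set_system setT (W t) measurable >>.

(* The second parameter of [normal_prob] is the standard deviation. *)
Record standard_brownian (Ft : R -> set (set Omega)) (W : R -> Omega -> R) :
    Prop := {
  brownian_adapted : forall t : R, 0 <= t ->
    preimage_set_system setT (W t) measurable `<=` Ft t;
  brownian_start : {ae P, forall w, W 0 w = 0};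
  brownian_continuous :
    {ae P, forall w, {within [set t | 0 <= t], continuous (W ^~ w)}};
  brownian_increment_indep : forall s t : R, 0 <= s -> s < t ->
    independent
      (Ft s)
      (preimage_set_system setT (fun w => W t w - W s w) measurable);
  brownian_increment_normal : forall s t : R, 0 <= s -> s < t ->
    forall A : set R, measurable A ->
      P [set w | A (W t w - W s w)] = normal_prob 0 (Num.sqrt (t - s)) A }.

(* [(W1, W2)] are the real and imaginary parts of a complex Brownian motion. *)
Record complex_brownian (Ft : R -> set (set Omega))
    (W1 W2 : R -> Omega -> R) : Prop := {
  complex_brownian_re : standard_brownian Ft W1;
  complex_brownian_im : standard_brownian Ft W2;
  complex_brownian_indep :
    independent (process_sigma_algebra W1) (process_sigma_algebra W2) }.

End probability_space.

Definition homeomorphism_on (X Y : topologicalType) (A : set X) (B : set Y)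
    (f : X -> Y) (g : Y -> X) : Prop :=
  [/\ set_fun A B f, set_fun B A g,
      forall x, A x -> g (f x) = x, forall y, B y -> f (g y) = y &
      {within A, continuous f} /\ {within B, continuous g}].

Section flow.
Context (R : realType) (d : measure_display) (Omega : measurableType d).
Variable P : probability Omega R.
Variable e : R -> R * R -> Omega -> \bar R.
Variable phi : R -> R -> R * R -> Omega -> R * R.

Definition flow_domain (s t : R) (w : Omega) : set (R * R) :=
  [set x | (t%:E < e s x w)%E].

Definition flow_range (s t : R) (w : Omega) : set (R * R) :=
  (fun x => phi s t x w) @` flow_domain s t w.

(* [e] and [phi] are total functions; their values outside [0 <= s <= t < e s x]
   are irrelevant. *)
Record local_stochastic_flow : Prop := {
  lsf_e_measurable : forall (s : R) x, 0 <= s -> measurable_fun setT (e s x);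
  lsf_e_gt : forall (s : R) x w, 0 <= s -> (s%:E < e s x w)%E;
  lsf_e_lsc : forall w, lower_semicontinuous
    (fun p : subspace [set p : R * (R * R) | 0 <= p.1] => e p.1 p.2 w);
  lsf_measurable : forall (s t : R) x, 0 <= s -> s <= t ->
    measurable_fun [set w | flow_domain s t w x] (phi s t x);
  lsf_continuous : forall w,
    {within [set p : R * R * (R * R) |
              0 <= p.1.1 <= p.1.2 /\ flow_domain p.1.1 p.1.2 w p.2],
     continuous (fun p : R * R * (R * R) => phi p.1.1 p.1.2 p.2 w)};
  lsf_id : {ae P, forall w, forall (s : R) x, 0 <= s -> phi s s x w = x};
  lsf_homeomorphism : {ae P, forall w,
    exists psi : R -> R -> R * R -> R * R,
      (forall s t : R, 0 <= s -> s < t ->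
         homeomorphism_on (flow_domain s t w) (flow_range s t w)
           (fun x => phi s t x w) (psi s t)) /\
      {within [set p : R * R * (R * R) |
                0 <= p.1.1 < p.1.2 /\ flow_range p.1.1 p.1.2 w p.2],
       continuous (fun p : R * R * (R * R) => psi p.1.1 p.1.2 p.2)}};
  lsf_cocycle : {ae P, forall w, forall (s t u : R) x,
    0 <= s -> s <= t -> t <= u -> flow_domain s u w x ->
    flow_domain t u w (phi s t x w) /\
    phi s u x w = phi t u (phi s t x w) w} }.

(* Since the diffusion coefficient is the constant [sigma], the stochastic
   integral over [s, t] is [sigma * (B_t - B_s)], and the equation
   [dZ = b(Z) dt + sigma dB] makes sense path by path, for driving paths
   [(B1, B2)]. *)
Definition solution_on (b : R * R -> R * R) (sigma : R) (B1 B2 : R -> R)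
    (s : R) (x : R * R) (tau : \bar R) (z : R -> R * R) : Prop :=
  {within [set t | s <= t /\ (t%:E < tau)%E], continuous z} /\
  forall t : R, s <= t -> (t%:E < tau)%E ->
    (z t).1 = x.1 + \int[lebesgue_measure]_(u in `[s, t]) (b (z u)).1
              + sigma * (B1 t - B1 s) /\
    (z t).2 = x.2 + \int[lebesgue_measure]_(u in `[s, t]) (b (z u)).2
              + sigma * (B2 t - B2 s).

(* A solution is maximal, with explosion time [tau], if it leaves every bounded
   set as [t] increases to [tau] whenever [tau] is finite. *)
Definition maximal_solution (b : R * R -> R * R) (sigma : R) (B1 B2 : R -> R)
    (s : R) (x : R * R) (tau : \bar R) (z : R -> R * R) : Prop :=
  solution_on b sigma B1 B2 s x tau z /\
  forall r : R, tau = r%:E -> `|z t| @[t --> r^'-] --> +oo.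

(* The exceptional null set of [flow_maximal] does not depend on [(s, x)]. *)
Record flow_of_SDE (Ft : R -> set (set Omega)) (b : R * R -> R * R) (sigma : R)
    (W1 W2 : R -> Omega -> R) : Prop := {
  flow_local : local_stochastic_flow;
  flow_adapted : forall (s t : R) x (A : set (R * R)), 0 <= s -> s <= t ->
    measurable A -> Ft t [set w | flow_domain s t w x /\ A (phi s t x w)];
  flow_maximal : {ae P, forall w, forall (s : R) x, 0 <= s ->
    maximal_solution b sigma (W1 ^~ w) (W2 ^~ w) s x (e s x w)
      (fun t => phi s t x w)} }.

End flow.

Definition drift (R : realType) (n : nat) (F : R[i] -> R[i]) (z : R * R) :
    R * R :=
  ofC (toC z ^+ n + F (toC z)).

(* Main.v *)
Require Import Defs.
From HB Require Import structures.
From mathcomp Require Import all_boot all_order all_algebra.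
From mathcomp Require Import complex.
From mathcomp Require Import all_classical all_reals all_analysis measurable_realfun.
From mathcomp Require Import ring lra.

(** The blow-up happens along every continuous driving path and before any
prescribed time [T > 0], so that randomness only enters through the exceptional
null sets; [T = 1] is as good as any other value.

Fix a path and subtract the noise: for a solution [z], the process
[Y = z - sigma (B - B 0)] solves an ordinary differential equation whose right
hand side is the drift evaluated at [z], which is within the (bounded) size of
the noise of [Y]. Near the positive real axis [z = p + i q],
[z ^+ n = p ^+ n + i n q p ^+ n.-1 + ...], where the remainder is one power of [p]
smaller in each component. Hence, in a horizontal strip and far to the right, the
real part of the drift is at least [p ^+ 2 / 2], and its imaginary part has the
sign of [q] as soon as [|q|] exceeds a constant depending only on [F] and [n]: the
perturbation [F] is of order [p ^+ n.-1], and is beaten by [n q p ^+ n.-1]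
([drift_strip]). So, for [K] large compared with the noise, the strip [|Im Y| <= K]
repels on both of its sides, and [Re Y] increases inside it ([strip_dynamics]).

The positive real axis is unstable, hence a given starting point is likely to leave
the strip. But start from the whole vertical segment [x0 + i y] with
[|y| <= K + 1]: the [y] whose path leaves by the top form an open set, and so do those
leaving by the bottom; both sets are nonempty, and they are disjoint because a path
that has left through one side has not met the other side before ([strip_exit]). The
segment being connected, some [y] never leaves ([non_exiting]). For that starting
point the real part satisfies [Y' >= Y ^+ 2 / 8], so, for [x0] large, the path explodes
before [T] ([quadratic_growth_time]); since its imaginary part stays bounded, it is its
real part that tends to infinity ([blowup_along_path]). *)

Import Order.TTheory GRing.Theory Num.Theory.
Import numFieldNormedType.Exports.
Import ComplexField.Normc.

Local Open Scope classical_set_scope.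
Local Open Scope ring_scope.
Local Open Scope complex_scope.

Set Implicit Arguments.
Unset Strict Implicit.
Unset Printing Implicit Defensive.

Local Notation Re := complex.Re.
Local Notation Im := complex.Im.

(** * The drift in a horizontal strip *)

Lemma normc_bounds (R : realType) (a b : R) :
  [/\ `|a| <= normc (a +i* b), `|b| <= normc (a +i* b) &
      normc (a +i* b) <= `|a| + `|b|].
Proof.
split=> /=.
- by rewrite -sqrtr_sqr ler_wsqrtr // lerDl sqr_ge0.
- by rewrite -sqrtr_sqr ler_wsqrtr // lerDr sqr_ge0.
- rewrite -[leRHS]ger0_norm ?addr_ge0 // -sqrtr_sqr ler_wsqrtr //.
  rewrite sqrrD !real_normK ?num_real // addrAC lerDl.
  by rewrite mulrn_wge0 // mulr_ge0.
Qed.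

Lemma exprS_complex (R : realType) (p q : R) (n : nat) :
  Re ((p +i* q) ^+ n.+1) = p * Re ((p +i* q) ^+ n) - q * Im ((p +i* q) ^+ n) /\
  Im ((p +i* q) ^+ n.+1) = p * Im ((p +i* q) ^+ n) + q * Re ((p +i* q) ^+ n).
Proof. by rewrite exprS; case: (_ ^+ n) => u v. Qed.

(** The error is of relative order [1 / p] in the real part; in the imaginary part
it is of relative order [1 / p] compared with [p ^+ n], which is written with a
factor [p] to avoid the negative power of [p] at [n = 0]. *)
Lemma exprS_complex_expansion (R : realType) (Q : R) (n : nat) : 0 <= Q ->
  exists2 D, 0 <= D & forall p q : R, 1 <= p -> `|q| <= Q ->
    `|Re ((p +i* q) ^+ n.+1) - p ^+ n.+1| <= D * p ^+ n /\
    p * `|Im ((p +i* q) ^+ n.+1) - n.+1%:R * q * p ^+ n| <= D * p ^+ n.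
Proof.
move=> Q0; elim: n => [|n [D D0 IH]].
  exists 0 => // p q p1 qQ.
  by rewrite !expr1 /= expr0 mulr1 mul1r !subrr normr0 mulr0 mul0r.
exists (D + Q * (n.+1%:R * Q + D)).
  by rewrite addr_ge0 // mulr_ge0 // addr_ge0 // mulr_ge0.
move=> p q p1 qQ; have [IHr IHi] := IH p q p1 qQ.
have p0 : 0 <= p by rewrite (le_trans _ p1).
have [-> ->] := exprS_complex p q n.+1.
move: IHr IHi; set u := Re _; set v := Im _ => IHr IHi.
set X := p ^+ n.
have X0 : 0 <= X by rewrite exprn_ge0.
have Xp : X <= p * X by rewrite ler_peMl.
have vX : `|v| <= (n.+1%:R * Q + D) * X.
  have -> : v = (v - n.+1%:R * q * X) + n.+1%:R * q * X by rewrite subrK.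
  rewrite (le_trans (ler_normD _ _)) // addrC mulrDl lerD //.
    by rewrite !normrM ger0_norm // (ger0_norm X0) ler_wpM2r // ler_wpM2l.
  by rewrite (le_trans _ IHi) // ler_peMl.
rewrite !exprS -/X; split.
- have -> : p * u - q * v - p * (p * X) = p * (u - p * X) - q * v by ring.
  rewrite (le_trans (ler_normB _ _)) // mulrDl lerD //.
    rewrite normrM (ger0_norm p0) mulrCA ler_wpM2l //.
    by rewrite -exprS.
  rewrite normrM -mulrA ler_pM // (le_trans vX) // ler_wpM2l //.
  by rewrite addr_ge0 // mulr_ge0.
- have -> : p * v + q * u - n.+2%:R * q * (p * X) =
    p * (v - n.+1%:R * q * X) + q * (u - p * X).
    by rewrite -[n.+2%:R]natr1; ring.
  rewrite mulrCA ler_wpM2l // (le_trans (ler_normD _ _)) // mulrDl lerD //.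
    by rewrite normrM (ger0_norm p0).
  rewrite normrM -mulrA ler_pM // -exprS (le_trans IHr) // ler_wpM2r //.
  by rewrite lerDr mulr_ge0.
Qed.

(** The threshold [C0] depends only on the constant of the bound on [F], and not on the
width [Q] of the strip, which only influences how far to the right one has to go. This
is what allows choosing the width after [C0], and after the size of the noise. *)
Lemma drift_strip (R : realType) (n : nat) (F : R[i] -> R[i]) :
  (2 <= n)%N -> bigO_infty F n.-1 ->
  exists2 C0, 0 < C0 & forall Q, 0 <= Q -> exists2 A, 1 <= A &
    forall p q : R, A <= p -> `|q| <= Q ->
    [/\ p ^+ 2 / 2 <= (drift n F (p, q)).1,
        C0 <= q -> 0 <= (drift n F (p, q)).2 &
        q <= - C0 -> (drift n F (p, q)).2 <= 0].
Proof.
case: n => [//|[//|m]] _ [C [M FC]].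
(* the power of 2 comes from |z| <= 2 p, valid once p >= Q *)
pose C1 := `|C| * 2 ^+ m.+1.
have C10 : 0 <= C1 by rewrite mulr_ge0 // exprn_ge0.
exists (C1 + 1) => [|Q Q0]; first by rewrite ltr_wpDl.
have [D D0 HD] := exprS_complex_expansion m.+1 Q0.
pose A := 1 + Q + `|M| + 2 * (D + C1).
have A1 : 1 <= A by rewrite /A -!addrA lerDl !addr_ge0 // mulr_ge0 // addr_ge0.
exists A => // p q Ap qQ.
have p1 : 1 <= p by exact: le_trans Ap.
have p0 : 0 <= p by exact: le_trans p1.
have [Dr Di] := HD p q p1 qQ.
have [nu nv nuv] := normc_bounds p q.
have DC : 0 <= 2 * (D + C1) by rewrite mulr_ge0 // addr_ge0.
have nM := normr_ge0 M.
have [Fr Fi] : `|Re (F (p +i* q))| <= C1 * p ^+ m.+1 /\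
    `|Im (F (p +i* q))| <= C1 * p ^+ m.+1.
  have /FC : M%:C <= `|p +i* q|.
    rewrite lecR (le_trans (ler_norm M)) //; apply: le_trans nu.
    rewrite (ger0_norm p0) (le_trans _ Ap) // /A; lra.
  have -> : `|p +i* q| = (normc (p +i* q))%:C by [].
  have -> : `|F (p +i* q)| = (normc (F (p +i* q)))%:C by [].
  rewrite -rmorphXn -rmorphM lecR => Fn.
  have bnd : normc (F (p +i* q)) <= C1 * p ^+ m.+1.
    have nc0 : 0 <= normc (p +i* q) by apply: le_trans nu.
    apply: (le_trans Fn); rewrite /C1 -mulrA -exprMn.
    apply: (@le_trans _ _ (`|C| * normc (p +i* q) ^+ m.+1)).
      by rewrite ler_wpM2r ?ler_norm // exprn_ge0.
    rewrite ler_wpM2l // lerXn2r ?nnegrE ?mulr_ge0 //.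
    rewrite (le_trans nuv) // (ger0_norm p0) mulr_natl mulr2n lerD2l (le_trans qQ) //.
    by rewrite (le_trans _ Ap) // /A; lra.
  case: (F _) bnd => a b bnd /=; have [na nb _] := normc_bounds a b.
  by split; [apply: le_trans bnd | apply: le_trans bnd].
rewrite /drift /toC /=.
have -> : ofC ((p +i* q) ^+ m.+2 + F (p +i* q)) =
  (Re ((p +i* q) ^+ m.+2) + Re (F (p +i* q)),
   Im ((p +i* q) ^+ m.+2) + Im (F (p +i* q))).
  by case: (_ ^+ _) (F _) => a b [c d].
rewrite /=; move: Dr Di Fr Fi.
set u := Re (_ ^+ _); set v := Im (_ ^+ _); set Fu := Re _; set Fv := Im _.
rewrite exprS; set X := p ^+ m.+1 => Dr Di Fr Fi.
have X0 : 0 <= X by rewrite exprn_ge0.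
have Xp : p <= X by rewrite /X exprS ler_peMr // exprn_ege1.
move: Dr Fr Fi; rewrite !ler_norml => /andP[Dr _] /andP[Fr _] /andP[Fi1 Fi2].
have Ap2 : 2 * (D + C1) <= p by apply: le_trans Ap; rewrite /A; lra.
have kq : 0 <= (m.+1)%:R * `|q| * X by rewrite !mulr_ge0.
have pp : 0 < p by rewrite (lt_le_trans _ p1).
have XDC : (D + C1) * X <= p * X / 2.
  by have := ler_wpM2r X0 Ap2; lra.
have CX : 0 <= C1 * X by rewrite mulr_ge0.
have pX : 0 <= p * X by rewrite mulr_ge0.
have m2 : 1 <= m.+2%:R :> R by rewrite ler1n.
have := Di; rewrite -{1}(ger0_norm p0) -normrM ler_norml => /andP[Di1 Di2].
split.
- apply: (@le_trans _ _ (p * X / 2)); last by lra.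
  by rewrite ler_pM2r ?invr_gt0 // expr2 ler_wpM2l.
(* multiply by p, so that the expansion of the imaginary part applies *)
- move=> Cq; rewrite -(pmulr_rge0 _ pp).
  have Fp := ler_wpM2l p0 Fi1.
  have qX : (C1 + 1) * (p * X) <= q * (p * X) by rewrite ler_wpM2r.
  have mX : q * (p * X) <= m.+2%:R * (q * (p * X)).
    by rewrite ler_peMl // (le_trans _ qX) // mulr_ge0 // addr_ge0.
  by move: m2 mX Di1; set k := m.+2%:R; move=> m2 mX Di1; lra.
- move=> Cq; rewrite -(pmulr_rle0 _ pp).
  have Fp := ler_wpM2l p0 Fi2.
  have qX : q * (p * X) <= - (C1 + 1) * (p * X) by rewrite ler_wpM2r.
  have mX : m.+2%:R * (q * (p * X)) <= q * (p * X).
    rewrite ler_neMl // (le_trans qX) // mulNr oppr_le0 mulr_ge0 //.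
    by rewrite addr_ge0.
  by move: m2 mX Di2; set k := m.+2%:R; move=> m2 mX Di2; lra.
Qed.

Lemma continuous_toC (R : realType) : continuous (fun p : R * R => toC p : R[i]^o).
Proof.
move=> p; apply/cvgrPdist_lt => eps; case: eps => e f.
rewrite ltcE /= => /andP[/eqP -> e0].
have e20 : 0 < e / 2 by rewrite divr_gt0.
have c1 : (fun q : R * R => q.1) @ p --> p.1 by exact: cvg_fst.
have c2 : (fun q : R * R => q.2) @ p --> p.2 by exact: cvg_snd.
move/cvgrPdist_lt/(_ _ e20): c1; move/cvgrPdist_lt/(_ _ e20): c2.
apply: filterS2 => q q2 q1.
have -> : `|toC p - toC q| = (normc (toC p - toC q))%:C by [].
rewrite ltcR.
have -> : toC p - toC q = (p.1 - q.1) +i* (p.2 - q.2).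
  by case: p q {q1 q2} => ? ? [? ?].
have [_ _] := normc_bounds (p.1 - q.1) (p.2 - q.2) => /le_lt_trans; apply.
rewrite [e](_ : _ = e / 2 + e / 2) ?ltrD //; lra.
Qed.

Lemma continuous_Re_Im (R : realType) :
  continuous (fun z : R[i]^o => Re z : R) /\
  continuous (fun z : R[i]^o => Im z : R).
Proof.
have ReIm_lt (z w : R[i]) (e : R) : `|z - w| < e%:C ->
    `|Re z - Re w| < e /\ `|Im z - Im w| < e.
  have -> : `|z - w| = (normc (z - w))%:C by [].
  rewrite ltcR; case: z w => a b [c d] /= ze.
  have [na nb _] := normc_bounds (a - c) (b - d).
  by split; [exact: le_lt_trans ze | exact: le_lt_trans ze].
split=> z; apply/(@cvgrPdist_lt _ _ _ (nbhs (z : R[i]^o))) => e e0.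
all: have cid : (fun w : R[i]^o => w) @ (z : R[i]^o) --> (z : R[i]^o) by exact: cvg_id.
all: have ec : (0 : R[i]) < e%:C by rewrite ltcR.
all: by move/cvgrPdist_lt/(_ _ ec): cid; apply: filterS => w /ReIm_lt[].
Qed.

Lemma continuous_locally_lipschitz (R : realType) (F : R[i] -> R[i]) :
  locally_lipschitz F -> continuous (F : R[i]^o -> R[i]^o).
Proof.
move=> hF c; have [A Ac lip] := hF c.
have [k k0 kA] : exists2 k : R[i], 0 < k & forall x, A x -> `|F c - F x| <= k * `|c - x|.
  move: lip; rewrite /lipschitz_on => -[M [Mr HM]].
  exists (`|M| + 1); first by rewrite ltr_wpDl.
  move=> x Ax; apply: (HM (`|M| + 1) _ (c, x)) => /=.
    by rewrite (le_lt_trans (real_ler_norm Mr)) // ltrDl.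
  by split=> //; exact: nbhs_singleton Ac.
have cid : (fun w : R[i]^o => w) @ c --> c by exact: cvg_id.
apply/(@cvgrPdist_lt _ _ _ (nbhs c)) => e e0.
have ek : 0 < k^-1 * e by rewrite mulr_gt0 // invr_gt0.
move/(@cvgrPdist_lt _ _ _ (nbhs c))/(_ _ ek): cid; apply: filterS2 Ac => x /kA Fx cx.
by rewrite (le_lt_trans Fx) // -ltr_pdivlMl.
Qed.

Lemma continuous_complex_pow (R : realType) (n : nat) :
  continuous (fun z : R * R => Re (toC z ^+ n)) /\
  continuous (fun z : R * R => Im (toC z ^+ n)).
Proof.
elim: n => [|n [IHr IHi]].
  by split=> z; exact: cvg_cst.
have c1 (z : R * R) : (fun q : R * R => q.1) @ z --> z.1 by exact: cvg_fst.
have c2 (z : R * R) : (fun q : R * R => q.2) @ z --> z.2 by exact: cvg_snd.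
split=> z.
- rewrite /continuous_at (exprS_complex z.1 z.2 n).1.
  under eq_fun => w do rewrite [Re _](exprS_complex w.1 w.2 n).1.
  by apply: cvgB; apply: cvgM; [exact: c1 | exact: IHr | exact: c2 | exact: IHi].
- rewrite /continuous_at (exprS_complex z.1 z.2 n).2.
  under eq_fun => w do rewrite [Im _](exprS_complex w.1 w.2 n).2.
  by apply: cvgD; apply: cvgM; [exact: c1 | exact: IHi | exact: c2 | exact: IHr].
Qed.

Lemma continuous_drift (R : realType) (n : nat) (F : R[i] -> R[i]) :
  locally_lipschitz F ->
  continuous (fun z => (drift n F z).1) /\ continuous (fun z => (drift n F z).2).
Proof.
move=> /continuous_locally_lipschitz cF; have [cR cI] := continuous_Re_Im R.
have [pR pI] := continuous_complex_pow R n.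
have cFC : continuous (fun z : R * R => F (toC z) : R[i]^o).
  by move=> z; exact: (continuous_comp (@continuous_toC R z) (cF (toC z))).
have E1 : (fun z => (drift n F z).1) = (fun z => Re (toC z ^+ n) + Re (F (toC z))).
  by apply/funext => z; rewrite /drift; case: (_ ^+ _) (F _) => ? ? [].
have E2 : (fun z => (drift n F z).2) = (fun z => Im (toC z ^+ n) + Im (F (toC z))).
  by apply/funext => z; rewrite /drift; case: (_ ^+ _) (F _) => ? ? [].
rewrite E1 E2; split=> z.
- by apply: cvgD; [exact: pR | apply: (continuous_comp (@cFC z)); exact: cR].
- by apply: cvgD; [exact: pI | apply: (continuous_comp (@cFC z)); exact: cI].
Qed.

(** * Barriers and the dynamics in a strip *)

Lemma continuous_subitv (R : realType) (f : R -> R) (a b u v : R) :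
  {within `[a, b], continuous f} -> a <= u -> v <= b ->
  {within `[u, v], continuous f}.
Proof.
move=> cf au vb; apply: continuous_subspaceW cf => x /=; rewrite !in_itv /=.
by case/andP=> ux xv; rewrite (le_trans au ux) (le_trans xv vb).
Qed.

Lemma compact_superlevel (R : realType) (f : R -> R) (a b c : R) :
  {within `[a, b], continuous f} -> compact [set x | a <= x <= b /\ c <= f x].
Proof.
move=> cf.
have /closed_subspaceP [V cV VE] :
    closed (f @^-1` [set y | c <= y] : set (subspace `[a, b])).
  by move/continuous_closedP : cf; apply; exact: closed_ge.
have -> : [set x | a <= x <= b /\ c <= f x] = `[a, b] `&` V.
  by rewrite setIC VE; apply/seteqP; split=> x /=; rewrite in_itv /= => -[].
by apply: compact_closedI; [exact: segment_compact | exact: cV].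
Qed.

Lemma last_time_above (R : realType) (f : R -> R) (a b c : R) :
  {within `[a, b], continuous f} -> a <= b -> c <= f a ->
  exists s, [/\ a <= s <= b, c <= f s & forall x, s < x <= b -> f x < c].
Proof.
move=> cf ab fa.
have [||s] := @compact_EVT_max _ _ idfun _ _ (compact_superlevel (c := c) cf).
- by exists a; rewrite /= lexx ab.
- by apply: continuous_subspaceT => x; exact: cvg_id.
rewrite inE => -[/= sab fs] smax; exists s; split=> // x /andP[sx xb].
rewrite ltNge; apply/negP => fx.
have : x <= s.
  apply: smax; rewrite inE /= xb fx (le_trans _ (ltW sx)) //.
  by case/andP: sab.
by rewrite leNgt sx.
Qed.

Lemma first_time_above (R : realType) (f : R -> R) (a b c : R) :
  {within `[a, b], continuous f} -> a <= b -> f a < c -> c <= f b ->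
  exists s, [/\ a <= s <= b, f s = c & forall x, a <= x < s -> f x < c].
Proof.
move=> cf ab fa fb.
have [||s] := @compact_EVT_min _ _ idfun _ _ (compact_superlevel (c := c) cf).
- by exists b; rewrite /= lexx ab.
- by apply: continuous_subspaceT => x; exact: cvg_id.
rewrite inE => -[/= sab fs] smin.
have below x : a <= x < s -> f x < c.
  case/andP=> ax xs; rewrite ltNge; apply/negP => fx.
  have : s <= x.
    by apply: smin; rewrite inE /= ax fx (le_trans (ltW xs)) //; case/andP: sab.
  by rewrite leNgt xs.
exists s; split=> //; case/andP: sab => as_ sb.
have [||x + fx] := @IVT _ f a s c as_.
- exact: continuous_subitv cf (lexx a) sb.
- by rewrite ge_min le_max (ltW fa) fs orbT.
rewrite in_itv /= => /andP[ax]; rewrite le_eqVlt => /orP[/eqP <-//|xs].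
by have := below x; rewrite fx ltxx ax xs => /(_ isT).
Qed.

(** If [f] went below [c], then after the last time spent above [c] it would have to
decrease across a layer below [c], where its derivative is nonnegative. The width 1 of
that layer is arbitrary, but fixed: in a strip, the direction of the drift is only known
close to the sides. *)
Lemma barrier (R : realType) (f df : R -> R) (a b c : R) :
  {within `[a, b], continuous f} ->
  (forall x, x \in `]a, b[ -> is_derive x 1 f (df x)) ->
  (forall x, x \in `]a, b[ -> c - 1 <= f x <= c -> 0 <= df x) ->
  c <= f a -> forall t, a <= t <= b -> c <= f t.
Proof.
move=> cf dfE df0 fa t /andP[at_ tb]; rewrite leNgt; apply/negP => ft.
have subc u v := @continuous_subitv R f a b u v cf.
have [s [/andP[as_ st] fs below]] := last_time_above (subc _ _ (lexx a) tb) at_ fa.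
have cNf : {within `[s, t], continuous (- f)}.
  by move=> x; apply: continuousN; exact: (subc s t as_ tb).
(* the first time at which the level v, below c but inside the layer, is reached *)
pose v := Num.max (c - 1) (f t).
have vc : v < c by rewrite /v gt_max ft andbT ltrBlDr ltrDl.
have [||u [/andP[su ut] fu above]] :=
  @first_time_above _ (- f) s t (- v) cNf st.
- by rewrite /= ltrN2 (lt_le_trans vc).
- by rewrite /= lerN2 /v le_max lexx orbT.
have {}fu : f u = v by apply: oppr_inj; exact: fu.
have su' : s < u.
  by rewrite lt_neqAle su andbT; apply/eqP => E; move: fs; rewrite E fu leNgt vc.
have ub : u <= b by exact: le_trans ut tb.
have insub x : x \in `]s, u[ -> x \in `]a, b[.
  rewrite !in_itv /= => /andP[sx xu].
  by rewrite (le_lt_trans as_ sx) (lt_le_trans xu ub).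
have [x xsu E] := MVT su' (fun x xs => dfE x (insub x xs)) (subc s u as_ ub).
have : 0 <= df x.
  apply: df0; first exact: insub.
  move: xsu; rewrite in_itv /= => /andP[sx xu].
  rewrite ltW/=; last first.
    have : v < f x by rewrite -ltrN2; apply: above; rewrite (ltW sx) xu.
    by apply: le_lt_trans; rewrite /v le_max lexx.
  by apply/ltW/below; rewrite sx (le_trans (ltW xu)).
move=> dfx; have : 0 <= f u - f s by rewrite E mulr_ge0 // subr_ge0.
by rewrite subr_ge0 fu leNgt (lt_le_trans vc fs).
Qed.

(** [y1 + i y2] is a path in the strip [|y2| <= K + 1], with velocity [g1 + i g2] pointing
to the right and, near the lines [y2 = K] and [y2 = - K], away from the real axis. The
hypotheses on the drift only hold for [y1 >= x0 - 1]; a first use of the barrier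
argument shows that the path never gets out of that region, and two further ones, that
it cannot come back across the lines. *)
Lemma strip_dynamics (R : realType) (y1 y2 g1 g2 : R -> R) (T x0 K : R) :
  {within `[0, T], continuous y1} -> {within `[0, T], continuous y2} ->
  (forall t, t \in `]0, T[ -> is_derive t 1 y1 (g1 t)) ->
  (forall t, t \in `]0, T[ -> is_derive t 1 y2 (g2 t)) ->
  (forall t, t \in `]0, T[ -> x0 - 1 <= y1 t -> `|y2 t| <= K + 1 ->
    [/\ 0 <= g1 t, K - 1 <= y2 t -> 0 <= g2 t &
        y2 t <= - (K - 1) -> g2 t <= 0]) ->
  x0 <= y1 0 -> (forall t, 0 <= t <= T -> `|y2 t| <= K + 1) ->
  [/\ forall t, 0 <= t <= T -> x0 <= y1 t,
      forall s t, 0 <= s -> s <= t -> t <= T -> K <= y2 s -> K <= y2 t &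
      forall s t, 0 <= s -> s <= t -> t <= T -> y2 s <= - K -> y2 t <= - K].
Proof.
move=> c1 c2 d1 d2 drift y10 y2K.
have ioW t : t \in `]0, T[ -> 0 <= t <= T.
  by rewrite in_itv /= => /andP[/ltW-> /ltW->].
have y1x0 : forall t, 0 <= t <= T -> x0 <= y1 t.
  apply: (barrier c1 d1) => // t tT /andP[x0t _].
  by have [] := drift t tT x0t (y2K t (ioW t tT)).
have y1x0' t : t \in `]0, T[ -> x0 - 1 <= y1 t.
  by move=> /ioW/y1x0; apply: le_trans; rewrite lerBlDr lerDl.
have io s t x : 0 <= s -> t <= T -> x \in `]s, t[ -> x \in `]0, T[.
  rewrite !in_itv /= => s0 tT /andP[sx xt].
  by rewrite (le_lt_trans s0 sx) (lt_le_trans xt tT).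
split=> // s t s0 st tT ys.
- have cs := continuous_subitv c2 s0 tT.
  have ds x (xst : x \in `]s, t[) := d2 x (io s t x s0 tT xst).
  have ts : s <= t <= t by rewrite st lexx.
  have B := @barrier R y2 g2 s t K cs ds.
  apply: (B _ ys t ts).
  move=> x /(io _ _ _ s0 tT) xT /andP[Kx _].
  by have [_ + _] := drift x xT (y1x0' x xT) (y2K x (ioW x xT)); apply.
- have cN : {within `[s, t], continuous (- y2)}.
    by move=> x; apply: continuousN; exact: (continuous_subitv c2 s0 tT).
  have ds x (xst : x \in `]s, t[) : is_derive x 1 (- y2) ((- g2) x).
    by apply: is_deriveN; apply: d2; exact: (io s t).
  have ts : s <= t <= t by rewrite st lexx.
  have ys' : K <= (- y2) s by rewrite /= lerNr.
  have B := @barrier R (- y2) (- g2) s t K cN ds.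
  rewrite lerNr; apply: (B _ ys' t ts).
  move=> x /(io _ _ _ s0 tT) xT /andP[Kx _]; rewrite /= oppr_ge0.
  have [_ _] := drift x xT (y1x0' x xT) (y2K x (ioW x xT)); apply.
  by rewrite lerNr.
Qed.

(** Unless it starts outside, the path is stopped at a time when it is outside the strip
of half-width [K] and has not yet left the strip of half-width [K + 1], where the
dynamics is known: had it reached the opposite side earlier, it would have stayed
beyond it. *)
Lemma strip_exit (R : realType) (y1 y2 g1 g2 : R -> R) (T x0 K : R) :
  {within `[0, T], continuous y1} -> {within `[0, T], continuous y2} ->
  (forall t, t \in `]0, T[ -> is_derive t 1 y1 (g1 t)) ->
  (forall t, t \in `]0, T[ -> is_derive t 1 y2 (g2 t)) ->
  (forall t, t \in `]0, T[ -> x0 - 1 <= y1 t -> `|y2 t| <= K + 1 ->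
    [/\ 0 <= g1 t, K - 1 <= y2 t -> 0 <= g2 t &
        y2 t <= - (K - 1) -> g2 t <= 0]) ->
  x0 <= y1 0 -> 0 < K -> 0 <= T -> K < `|y2 T| ->
  exists2 t, 0 <= t <= T &
    (K < y2 t /\ forall s, 0 <= s <= t -> - K < y2 s) \/
    (y2 t < - K /\ forall s, 0 <= s <= t -> y2 s < K).
Proof.
move=> c1 c2 d1 d2 drift y10 K0 T0 KT.
have cn : {within `[0, T], continuous (fun t => `|y2 t|)}.
  by move=> x; apply: continuous_comp; [exact: c2 | exact: norm_continuous].
have [y2K|Ky2] := leP `|y2 0| K; last first.
  exists 0; first by rewrite lexx.
  move: Ky2; rewrite ltr_normr => /orP[Ky|Ky]; [left|right].
    split=> // s; rewrite -eq_le => /eqP <-.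
    by rewrite (lt_trans _ Ky) // (lt_trans _ K0) // oppr_lt0.
  split=> [|s]; first by rewrite ltrNr.
  rewrite -eq_le => /eqP <-.
  by rewrite (lt_trans _ K0) // -oppr_gt0 (lt_trans K0 Ky).
have [t [tT Kt {}y2K]] :
    exists t, [/\ 0 <= t <= T, K < `|y2 t| &
      forall s, 0 <= s <= t -> `|y2 s| <= K + 1].
  have [allK|] := pselect (forall s, 0 <= s <= T -> `|y2 s| <= K + 1).
    by exists T; rewrite T0 lexx.
  move=> /existsNP[s /not_implyP[/andP[s0 sT] /negP]]; rewrite -ltNge => Ks.
  have cs := continuous_subitv cn (lexx 0) sT.
  have [|t [/andP[t0 ts] yt below]] :=
    @first_time_above _ (fun t => `|y2 t|) 0 s (K + 1) cs s0 _ (ltW Ks).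
  - by rewrite (le_lt_trans y2K) // ltrDl.
  - exists t; rewrite t0 (le_trans ts sT) yt; split=> [//||u /andP[u0]].
      by rewrite ltrDl.
    rewrite le_eqVlt => /orP[/eqP->|ut]; first by rewrite yt.
    by apply/ltW/below; rewrite u0.
case/andP: (tT) => t0 t_T.
have c1t := continuous_subitv c1 (lexx 0) t_T.
have c2t := continuous_subitv c2 (lexx 0) t_T.
have io x : x \in `]0, t[ -> x \in `]0, T[.
  by rewrite !in_itv /= => /andP[-> /lt_le_trans->].
have [_ up down] := @strip_dynamics _ _ _ _ _ t x0 K c1t c2t
  (fun x xt => d1 x (io x xt)) (fun x xt => d2 x (io x xt))
  (fun x xt => drift x (io x xt)) y10 y2K.
exists t => //; move: Kt; rewrite ltr_normr => /orP[Ky|Ky]; [left|right].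
  split=> // s /andP[s0 st]; rewrite ltNge; apply/negP => /(down s t s0 st (lexx t)).
  by rewrite leNgt (lt_trans _ Ky) // (lt_trans _ K0) // oppr_lt0.
split=> [|s /andP[s0 st]]; first by rewrite ltrNr.
rewrite ltNge; apply/negP => /(up s t s0 st (lexx t)).
by rewrite leNgt (lt_trans _ K0) // -oppr_gt0 (lt_trans K0 Ky).
Qed.

(** [1 / y] decreases at rate at least [1 / 8], and it is positive at time [T]. *)
Lemma quadratic_growth_time (R : realType) (y dy : R -> R) (x0 T : R) :
  0 < T -> 0 < x0 -> {within `[0, T], continuous y} ->
  (forall t, t \in `]0, T[ -> is_derive t 1 y (dy t)) ->
  (forall t, 0 <= t <= T -> x0 <= y t) ->
  (forall t, t \in `]0, T[ -> y t ^+ 2 / 8 <= dy t) -> x0 * T <= 8.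
Proof.
move=> T0 x00 cy yd yx dyq.
have y0 t : 0 <= t <= T -> 0 < y t by move=> /yx; exact: lt_le_trans.
have cV : {within `[0, T], continuous (fun t => (y t)^-1)}.
  apply/subspace_continuousP => t tT; apply: cvgV.
    by rewrite gt_eqF // y0 //; move: tT; rewrite /= in_itv.
  by move/subspace_continuousP : cy; apply.
have io t : t \in `]0, T[ -> 0 <= t <= T.
  by rewrite in_itv /= => /andP[/ltW-> /ltW->].
have dV t (tT : t \in `]0, T[) :
    is_derive t 1 (fun t => (y t)^-1) (- (y t) ^- 2 *: dy t).
  by apply: is_deriveV; [rewrite gt_eqF // y0 // io | exact: yd].
have [t tT] := MVT T0 dV cV.
have yt := y0 t (io t tT).
have b0 : x0 <= y 0 by apply: yx; rewrite lexx ltW.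
have bT : 0 < (y T)^-1 by rewrite invr_gt0 y0 // lexx ltW.
have : 1 / 8 <= (y t) ^- 2 * dy t.
  by rewrite ler_pdivlMl ?exprn_gt0 // mulrA mulr1; exact: dyq.
rewrite subr0 scaleNr /GRing.scale /= => q8 E.
have : T / 8 <= (y 0)^-1.
  have : T * (1 / 8) <= T * (y t ^- 2 * dy t) by rewrite ler_pM2l.
  lra.
have : (y 0)^-1 <= x0^-1 by rewrite lef_pV2 // posrE // (lt_le_trans x00).
move=> /[swap] /le_trans /[apply].
by rewrite -[leRHS]mul1r ler_pdivlMr // mulrAC ler_pdivrMr // mul1r mulrC.
Qed.

(** * A starting point whose path stays in the strip *)

(** A tube lemma: by compactness of the time interval [a, t], a strict inequality
satisfied by the path started at [y] persists for nearby starting points. The case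
[a = t] is continuity at a fixed time. *)
Lemma tube (R : realType) (e : R -> \bar R) (Y : R -> R -> R) (v a t y : R) :
  0 <= a ->
  (forall y t, (t%:E < e y)%E -> \forall y' \near y, (t%:E < e y')%E) ->
  {within [set p : R * R | 0 <= p.1 /\ (p.1%:E < e p.2)%E],
     continuous (fun p => Y p.1 p.2)} ->
  (t%:E < e y)%E -> (forall s, a <= s <= t -> v < Y s y) ->
  \forall y' \near y, (t%:E < e y')%E /\ forall s, a <= s <= t -> v < Y s y'.
Proof.
move=> a0 eopen /subspace_continuousP cY te vY.
have cov : \forall y' \near y,
    `[a, t] `<=` (fun s => (t%:E < e y')%E -> v < Y s y').
  have /compact_near_coveringP/near_covering_withinP nc := @segment_compact R a t.
  apply: (nc _ (nbhs y) (fun y' s => (t%:E < e y')%E -> v < Y s y')) => s.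
  rewrite /= in_itv /= => st; have /andP[as_ s_t] := st; have s0 := le_trans a0 as_.
  have As : [set p : R * R | 0 <= p.1 /\ (p.1%:E < e p.2)%E] (s, y).
    by split=> //=; rewrite (le_lt_trans _ te) // lee_fin.
  have := cY (s, y) As [set r | v < r]; rewrite /= nbhs_simpl /=.
  have /= nv : nbhs (Y s y) [set r | v < r] by apply: lt_nbhsr; exact: vY.
  move=> /(_ nv) [[U V] /= [Us Vy] UV].
  exists (U, V) => //= -[s' y'] [/= Us' Vy'] /=.
  rewrite in_itv /= => /andP[as' s't] ty'.
  apply: (UV (s', y')) => //=; split; first exact: le_trans as'.
  by rewrite (le_lt_trans _ ty') // lee_fin.
apply: filterS2 (eopen y t te) cov => y' ty' H; split=> // s st.
by apply: H; rewrite //= in_itv.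
Qed.

(** [Y s y] is the height at time [s] of the path started at height [y], and [e y] is its
lifetime. The alternative assumed for the paths leaving [[-K, K]] says that they do so
through one side without having met the other side before, which makes the two kinds of
exit exclusive and, by the tube lemma, open conditions on [y]. *)
Lemma non_exiting (R : realType) (e : R -> \bar R) (Y : R -> R -> R) (K T : R) :
  0 < K -> 0 <= T -> (forall y, (0%:E < e y)%E) ->
  (forall y t, (t%:E < e y)%E -> \forall y' \near y, (t%:E < e y')%E) ->
  {within [set p : R * R | 0 <= p.1 /\ (p.1%:E < e p.2)%E],
     continuous (fun p => Y p.1 p.2)} ->
  (forall y, Y 0 y = y) ->
  (forall y t, 0 <= t <= T -> (t%:E < e y)%E -> K < `|Y t y| ->
    exists2 s, 0 <= s <= t &
      (K < Y s y /\ forall u, 0 <= u <= s -> - K < Y u y) \/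
      (Y s y < - K /\ forall u, 0 <= u <= s -> Y u y < K)) ->
  exists y, forall t, 0 <= t <= T -> (t%:E < e y)%E -> `|Y t y| <= K.
Proof.
move=> K0 T0 e0 eopen cY Y0 exit; apply: contrapT => noy.
(* exit through the top; exit through the bottom is an exit of - Y through the top *)
pose exits (Z : R -> R -> R) := [set y | exists t,
  [/\ 0 <= t, (t%:E < e y)%E, K < Z t y &
      forall s, 0 <= s <= t -> - K < Z s y]].
have openU Z : {within [set p : R * R | 0 <= p.1 /\ (p.1%:E < e p.2)%E],
     continuous (fun p => Z p.1 p.2)} -> open (exits Z).
  move=> cZ; rewrite openE => y [t [t0 te Kt ns]].
  have Kt1 s : t <= s <= t -> K < Z s y by rewrite -eq_le => /eqP <-.
  have near1 := tube (lexx 0) eopen cZ te ns.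
  have near2 := tube t0 eopen cZ te Kt1.
  suff : \forall y' \near y, exits Z y' by [].
  apply: filterS2 near1 near2 => y' [te' ns'] [_ /(_ t)].
  rewrite lexx => /(_ isT) Kt'.
  by exists t.
pose NY t y := - Y t y.
have cNY : {within [set p : R * R | 0 <= p.1 /\ (p.1%:E < e p.2)%E],
     continuous (fun p => NY p.1 p.2)}.
  by move=> p; apply: cvgN; exact: cY.
have cover y : exits Y y \/ exits NY y.
  have : exists t, [/\ 0 <= t <= T, (t%:E < e y)%E & K < `|Y t y|].
    apply: contrapT => nt; apply: noy; exists y => t tT te.
    by rewrite leNgt; apply/negP => Kt; apply: nt; exists t.
  move=> [t [tT te Kt]]; have [s /andP[s0 st]] := exit y t tT te Kt.
  have se : (s%:E < e y)%E by rewrite (le_lt_trans _ te) // lee_fin.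
  move=> [[Ks sN]|[Ks sN]]; [left|right]; exists s; split=> //.
    by rewrite /NY ltrNr.
  by move=> u /sN; rewrite /NY ltrN2.
have disj y : exits Y y -> exits NY y -> False.
  move=> [t [t0 te Kt nt]] [s [s0 se Ks ns]].
  have [ts|st] := leP t s.
    by have := ns t; rewrite t0 ts /NY ltrN2 => /(_ isT); rewrite ltNge (ltW Kt).
  have := nt s; rewrite s0 (ltW st) => /(_ isT); rewrite ltNge => /negP; apply.
  by move: Ks; rewrite /NY ltrNr => /ltW.
have exitsP y : K < y -> exits Y y.
  move=> Ky; exists 0; split; rewrite ?Y0 // => s; rewrite -eq_le => /eqP <-.
  by rewrite Y0 (lt_trans _ Ky) // gtrN.
have exitsN y : y < - K -> exits NY y.
  rewrite ltrNr => Ky; exists 0; split; rewrite /NY ?Y0 // => s.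
  rewrite -eq_le => /eqP <-.
  by rewrite Y0 (lt_trans _ Ky) // gtrN.
have K10 : 0 <= K + 1 by rewrite addr_ge0 // ltW.
pose S : set R := `[- (K + 1), K + 1]%classic.
have /seteqP[_ SU] : S `&` exits Y = S.
  apply: segment_connected.
  - exists (K + 1); split; last by apply: exitsP; rewrite ltrDl.
    by rewrite /S /= in_itv /= lexx andbT ge0_cp.
  - by exists (exits Y) => //; exact: openU.
  - exists (~` exits NY); first by apply: open_closedC; exact: openU.
    apply/seteqP; split=> y [yS] yE; split=> //; first by move/(disj y yE).
    by have [|//] := cover y.
have [|_ /disj] := SU (- (K + 1)); first by rewrite /S /= in_itv /= lexx ge0_cp.
by apply; apply: exitsN; rewrite ltrN2 ltrDl.
Qed.

(** * Blow-up along one path *)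

Lemma within_continuous_comp (X Y Z : topologicalType) (A : set X) (D : set Y)
    (g : X -> Y) (f : Y -> Z) :
  continuous g -> (forall x, A x -> D (g x)) -> {within D, continuous f} ->
  {within A, continuous (f \o g)}.
Proof.
move=> cg AD /subspace_continuousP cf; apply/subspace_continuousP => x Ax.
apply: cvg_comp (cf (g x) (AD x Ax)) => U /=; rewrite /within /= !nbhs_simpl /= => DU.
have H : \forall y \near x, D (g y) -> U (g y) := cg x _ DU.
by apply: filterS H => y DUy /AD.
Qed.

Lemma integral_primitive (R : realType) (f y : R -> R) (x T : R) :
  0 <= T -> {within `[0, T], continuous f} ->
  (forall t, 0 <= t <= T -> y t = x + \int[lebesgue_measure]_(u in `[0, t]) f u) ->
  {within `[0, T], continuous y} /\
  forall t, t \in `]0, T[ -> is_derive t 1 y (f t).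
Proof.
move=> T0 cf yE; pose I t := \int[lebesgue_measure]_(u in `[0, t]) f u.
have intf : lebesgue_measure.-integrable `[0, T] (EFin \o f).
  by apply: continuous_compact_integrable => //; exact: segment_compact.
have cI := parameterized_integral_continuous T0 intf.
split.
  apply: (@subspace_eq_continuous _ _ _ (fun t => x + I t)).
    by move=> t; rewrite inE /= in_itv /= => tT; exact: (esym (yE t tT)).
  by move=> t; apply: cvgD; [exact: cvg_cst | exact: cI].
move=> t tT; have := tT; rewrite in_itv /= => /andP[t0 t1].
have ct : {for t, continuous f}.
  by have /(continuous_within_itvP _ (lt_trans t0 t1))[+ _ _] := cf; apply.
have [dI I't] := @continuous_FTC1_closed R f 0 t T t1 intf t0 ct.
apply: (@near_eq_is_derive _ _ _ (fun t => x + I t)).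
- near=> s; rewrite yE //; apply/andP; split; apply: ltW.
    by near: s; exact: lt_nbhsr.
  by near: s; exact: lt_nbhsl.
- have dIt : is_derive t 1 I (f t) by apply: DeriveDef => //; rewrite -derive1E.
  by rewrite -[f t]add0r; apply: is_deriveD.
Unshelve. all: by end_near. Qed.

Lemma noise_bound (R : realType) (B : R -> R) (sigma T : R) :
  {within [set t | 0 <= t], continuous B} -> 0 <= T ->
  exists2 M, 0 <= M & forall t, 0 <= t <= T -> `|sigma * (B t - B 0)| <= M.
Proof.
move=> cB T0; pose f t := `|sigma * (B t - B 0)|.
have cf : {within `[0, T], continuous f}.
  have sub : `[0, T] `<=` [set t | 0 <= t].
    by move=> t; rewrite /= in_itv /= => /andP[].
  have cB' := continuous_subspaceW sub cB.
  have cN : {within `[0, T], continuous (fun t => sigma * (B t - B 0))}.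
    move=> t; apply: cvgM; first exact: cvg_cst.
    by apply: cvgB; [exact: cB' | exact: cvg_cst].
  by move=> t; exact: (continuous_comp (cN t) (@norm_continuous _ R _)).
have [c _ fc] := EVT_max T0 cf.
by exists (f c) => [|t tT]; [exact: normr_ge0 | apply: fc; rewrite in_itv].
Qed.

(** Without the noise the integral equation has a primitive of a continuous function on
its right-hand side, so the path becomes differentiable. *)
Lemma solution_minus_noise (R : realType) (b : R * R -> R * R) (sigma : R)
    (B1 B2 : R -> R) (x : R * R) (tau : \bar R) (z : R -> R * R) (T : R) :
  continuous (fun p => (b p).1) -> continuous (fun p => (b p).2) ->
  solution_on b sigma B1 B2 0 x tau z -> 0 <= T -> (T%:E < tau)%E ->
  let y1 t := (z t).1 - sigma * (B1 t - B1 0) in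
  let y2 t := (z t).2 - sigma * (B2 t - B2 0) in
  [/\ {within `[0, T], continuous y1},
      forall t, t \in `]0, T[ -> is_derive t 1 y1 (b (z t)).1,
      {within `[0, T], continuous y2} &
      forall t, t \in `]0, T[ -> is_derive t 1 y2 (b (z t)).2].
Proof.
move=> cb1 cb2 [cz zE] T0 Ttau y1 y2.
have tau_lt t : 0 <= t <= T -> (t%:E < tau)%E.
  by move=> /andP[_ tT]; rewrite (le_lt_trans _ Ttau) // lee_fin.
have cz' : {within `[0, T], continuous z}.
  apply: continuous_subspaceW cz => t; rewrite /= in_itv /= => tT.
  by split; [case/andP: tT | exact: tau_lt].
have c1 : {within `[0, T], continuous (fun t => (b (z t)).1)}.
  by move=> t; exact: (continuous_comp (cz' t) (cb1 (z t))).
have c2 : {within `[0, T], continuous (fun t => (b (z t)).2)}.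
  by move=> t; exact: (continuous_comp (cz' t) (cb2 (z t))).
have [|C1 D1] := @integral_primitive _ _ y1 x.1 T T0 c1.
  move=> t tT; have /andP[t0 _] := tT.
  by have [E _] := zE t t0 (tau_lt t tT); rewrite /y1 E addrK.
have [|C2 D2] := @integral_primitive _ _ y2 x.2 T T0 c2.
  move=> t tT; have /andP[t0 _] := tT.
  by have [_ E] := zE t t0 (tau_lt t tT); rewrite /y2 E addrK.
by split.
Qed.

(** The hypotheses on [e] and [phi] are what the flow provides for the initial time 0 on
one sample path: a lower semicontinuous lifetime and joint continuity in time and
starting point. *)
Lemma blowup_along_path (R : realType) (n : nat) (F : R[i] -> R[i]) (sigma : R)
    (B1 B2 : R -> R) (e : R * R -> \bar R) (phi : R -> R * R -> R * R) (T : R) :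
  (2 <= n)%N -> locally_lipschitz F -> bigO_infty F n.-1 -> 0 < T ->
  {within [set t | 0 <= t], continuous B1} ->
  {within [set t | 0 <= t], continuous B2} ->
  (forall x, (0%:E < e x)%E) ->
  (forall x t, (t%:E < e x)%E -> \forall x' \near x, (t%:E < e x')%E) ->
  {within [set p : R * (R * R) | 0 <= p.1 /\ (p.1%:E < e p.2)%E],
     continuous (fun p => phi p.1 p.2)} ->
  (forall x, phi 0 x = x) ->
  (forall x, maximal_solution (drift n F) sigma B1 B2 0 x (e x) (phi ^~ x)) ->
  exists z, ereal_sup [set (phi t z).1%:E | t in
    [set t : R | 0 <= t <= T /\ (t%:E < e z)%E]] = +oo%E.
Proof.
move=> n2 hF hFO T0 cB1 cB2 e0 eopen cphi phi0 sol.
have [cb1 cb2] := continuous_drift n hF.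
have [C0 C00 strip] := drift_strip n2 hFO.
have [M1 M10 BM1] := noise_bound sigma cB1 (ltW T0).
have [M2 M20 BM2] := noise_bound sigma cB2 (ltW T0).
(* K - 1 leaves room for the noise above the threshold C0 *)
pose M := M1 + M2; pose K := C0 + M + 1.
have M0 : 0 <= M by rewrite addr_ge0.
have M1M : M1 <= M by rewrite lerDl.
have M2M : M2 <= M by rewrite lerDr.
have K0 : 0 < K by rewrite /K; lra.
have Q0 : 0 <= K + 1 + M by lra.
have [A A1 stripA] := strip (K + 1 + M) Q0.
(* x0 - 1 - M >= A, x0 >= 2 M, and x0 > 8 / T forbids survival up to T *)
pose x0 := A + 2 * M + 2 + 8 / T.
have x00 : 0 < x0.
  by rewrite /x0 ltr_wpDr ?divr_ge0 ?ltW //; lra.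
have T8 : 0 < 8 / T by rewrite divr_gt0.
pose Y1 t y := (phi t (x0, y)).1 - sigma * (B1 t - B1 0).
pose Y2 t y := (phi t (x0, y)).2 - sigma * (B2 t - B2 0).
pose E y := e (x0, y).
have Y10 y : Y1 0 y = x0 by rewrite /Y1 phi0 !subrr mulr0 subr0.
have Y20 y : Y2 0 y = y by rewrite /Y2 phi0 !subrr mulr0 subr0.
pose g y t := drift n F (phi t (x0, y)).
have path y t : 0 <= t -> (t%:E < E y)%E -> _ :=
  fun t0 te => solution_minus_noise cb1 cb2 (sol (x0, y)).1 t0 te.
have drift1 y t : 0 <= t <= T -> x0 - 1 <= Y1 t y -> `|Y2 t y| <= K + 1 ->
  [/\ A <= (phi t (x0, y)).1, `|(phi t (x0, y)).2| <= K + 1 + M,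
      Y1 t y - M <= (phi t (x0, y)).1 & `|(phi t (x0, y)).2 - Y2 t y| <= M].
  move=> tT y1x0 y2K; have := BM1 t tT; have := BM2 t tT.
  move: y1x0 y2K; rewrite /Y1 /Y2 /x0 !ler_norml.
  move: T8; set T8' := 8 / T; move=> T8.
  move=> ? /andP[? ?] /andP[? ?] /andP[? ?].
  by split; rewrite ?opprB; lra.
have drift2 y t : 0 <= t <= T -> x0 - 1 <= Y1 t y -> `|Y2 t y| <= K + 1 ->
  [/\ 0 <= (g y t).1, K - 1 <= Y2 t y -> 0 <= (g y t).2 &
      Y2 t y <= - (K - 1) -> (g y t).2 <= 0].
  move=> tT y1x0 y2K; have [zA zQ _ zM] := drift1 y t tT y1x0 y2K.
  have [g1 g2p g2n] := stripA _ _ zA zQ.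
  rewrite /g [phi t _]surjective_pairing; move: zM; rewrite ler_norml => /andP[? ?].
  split; first by rewrite (le_trans _ g1) // divr_ge0 // sqr_ge0.
    by move=> yK; apply: g2p; move: yK; rewrite /K; lra.
  by move=> yK; apply: g2n; move: yK; rewrite /K; lra.
have cline : continuous (fun y : R => (x0, y)).
  move=> y U [[V1 V2] /= [Vx Vy] VU]; apply: filterS Vy => y' Vy'.
  by apply: (VU (x0, y')); split=> //; exact: nbhs_singleton Vx.
have Eopen y t : (t%:E < E y)%E -> \forall y' \near y, (t%:E < E y')%E.
  by move=> /eopen te; exact: (cline y _ te).
have cY2 : {within [set p : R * R | 0 <= p.1 /\ (p.1%:E < E p.2)%E],
    continuous (fun p => Y2 p.1 p.2)}.
  have cg : continuous (fun p : R * R => (p.1, (x0, p.2))).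
    move=> p U [[V1 V2] /= [Vs /cline Vy] VU].
    by exists (V1, (fun y => V2 (x0, y))) => //= -[s y] [/= sV yV]; exact: VU.
  have cphi1 : {within [set p : R * R | 0 <= p.1 /\ (p.1%:E < E p.2)%E],
      continuous (fun p => phi p.1 (x0, p.2))}.
    exact: (within_continuous_comp cg (fun p Ap => Ap) cphi).
  have cphi2 : {within [set p : R * R | 0 <= p.1 /\ (p.1%:E < E p.2)%E],
      continuous (fun p => (phi p.1 (x0, p.2)).2)}.
    by move=> p; apply: cvg_comp (cphi1 p) _; exact: cvg_snd.
  have cfst : continuous (fun p : R * R => p.1) by move=> p; exact: cvg_fst.
  have cB : {within [set p : R * R | 0 <= p.1 /\ (p.1%:E < E p.2)%E],
      continuous (fun p => B2 p.1)}.
    by apply: (within_continuous_comp cfst _ cB2) => p [].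
  move=> p; apply: cvgB; first exact: cphi2.
  apply: cvgM; first exact: cvg_cst.
  by apply: cvgB; [exact: cB | exact: cvg_cst].
have ioW s t : t <= T -> s \in `]0, t[ -> 0 <= s <= T.
  by rewrite in_itv /= => tT /andP[/ltW-> /ltW/le_trans->].
have drift_io y t : t <= T -> forall s, s \in `]0, t[ -> x0 - 1 <= Y1 s y ->
    `|Y2 s y| <= K + 1 -> _ :=
  fun tT s st => drift2 y s (ioW s t tT st).
have x0Y y : x0 <= Y1 0 y by rewrite Y10.
have exit y t : 0 <= t <= T -> (t%:E < E y)%E -> K < `|Y2 t y| ->
    exists2 s, 0 <= s <= t &
      (K < Y2 s y /\ forall u, 0 <= u <= s -> - K < Y2 u y) \/
      (Y2 s y < - K /\ forall u, 0 <= u <= s -> Y2 u y < K).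
  move=> /andP[t0 tT] te Kt; have [c1 d1 c2 d2] := path y t t0 te.
  exact: (strip_exit c1 c2 d1 d2 (drift_io y t tT) (x0Y y) K0 t0 Kt).
have [y inside] := non_exiting K0 (ltW T0) (fun y => e0 (x0, y)) Eopen cY2 Y20 exit.
have inside1 t : 0 <= t <= T -> (t%:E < E y)%E -> `|Y2 t y| <= K + 1.
  by move=> tT te; rewrite (le_trans (inside t tT te)) // lerDl.
have Y1x0 t : 0 <= t <= T -> (t%:E < E y)%E -> x0 <= Y1 t y.
  move=> /andP[t0 tT] te; have [c1 d1 c2 d2] := path y t t0 te.
  have ins s : 0 <= s <= t -> `|Y2 s y| <= K + 1.
    move=> /andP[s0 st]; apply: inside1; first by rewrite s0 (le_trans st).
    by rewrite (le_lt_trans _ te) // lee_fin.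
  have [+ _ _] := strip_dynamics c1 c2 d1 d2 (drift_io y t tT) (x0Y y) ins.
  by apply; rewrite t0 lexx.
(* the path that stays in the strip cannot live beyond T *)
have ET : (E y <= T%:E)%E.
  rewrite leNgt; apply/negP => TE; have [c1 d1 c2 d2] := path y T (ltW T0) TE.
  have te t : 0 <= t <= T -> (t%:E < E y)%E.
    by move=> /andP[_ tT]; rewrite (le_lt_trans _ TE) // lee_fin.
  have : x0 * T <= 8.
    apply: (quadratic_growth_time T0 x00 c1 d1) => [t tT|t /(ioW t T (lexx T)) tT].
      exact: Y1x0 tT (te t tT).
    have x0t := Y1x0 t tT (te t tT).
    have [|zA zQ z1 _] := drift1 y t tT _ (inside1 t tT (te t tT)).
      by rewrite (le_trans _ x0t) // gerDl lerN10.
    have [g1 _ _] := stripA _ _ zA zQ.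
    rewrite -surjective_pairing in g1; apply: le_trans g1.
    rewrite -/(Y1 t y).
    have z2 : Y1 t y / 2 <= (phi t (x0, y)).1.
      by move: x0t z1 T8; rewrite /x0; set T8' := 8 / T; lra.
    have : (Y1 t y / 2) ^+ 2 <= (phi t (x0, y)).1 ^+ 2.
      have Y0 : 0 <= Y1 t y by rewrite (le_trans _ x0t) // ltW.
      by rewrite lerXn2r // nnegrE ?divr_ge0 // (le_trans _ z2) // divr_ge0.
    by rewrite expr_div_n; lra.
  apply/negP; rewrite -ltNge -ltr_pdivrMr // /x0 ltrDr; lra.
have [r Er] : exists r, E y = r%:E.
  have := e0 (x0, y); rewrite -/(E y); case: (E y) ET => // r _ _; by exists r.
have r0 : 0 < r by have := e0 (x0, y); rewrite -/(E y) Er lte_fin.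
have rT : r <= T by rewrite Er lee_fin in ET.
(* |phi| tends to infinity at r while the imaginary part is at most K + M *)
exists (x0, y); apply/eqyP => N N0.
have /cvgryPgt/(_ (N + K + M)) big := (sol (x0, y)).2 r Er.
have [t [[t0 tr] Nt]] : exists t, (0 < t /\ t < r) /\ N + K + M < `|phi t (x0, y)|.
  apply: (@filter_ex _ (r^'-)); near=> t; split; last by near: t.
  split; near: t; [exact: nbhs_left_gt | exact: nbhs_left_lt].
have tT : 0 <= t <= T by rewrite (ltW t0) (le_trans (ltW tr)).
have te : (t%:E < E y)%E by rewrite Er lte_fin.
apply: le_ereal_sup_tmp; exists (phi t (x0, y)).1%:E.
  by exists t => //; split.
rewrite lee_fin.
have x0t := Y1x0 t tT te.
have [|zA _ _ z2] := drift1 y t tT _ (inside1 t tT te).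
  by rewrite (le_trans _ x0t) // gerDl lerN10.
have := inside t tT te; move: Nt z2.
rewrite prod_normE /= lt_max => /orP[|].
  rewrite (ger0_norm (le_trans (le_trans ler01 A1) zA)) => ? _ _; lra.
move=> Nz; rewrite distrC => z2 YK.
have := ler_normB (Y2 t y) (Y2 t y - (phi t (x0, y)).2).
rewrite opprB addrCA subrr addr0; lra.
Unshelve. all: by end_near. Qed.

(** * Almost sure blow-up *)

Unset Implicit Arguments.

Theorem mainTheorem2 (R : realType) (d : measure_display)
    (Omega : measurableType d) (P : probability Omega R)
    (Ft : R -> set (set Omega)) (hFt : filtration_usual P Ft)
    (W1 W2 : R -> Omega -> R) (hB : complex_brownian P Ft W1 W2)
    (n : nat) (hn : (2 <= n)%N) (sigma : R) (hsigma : 0 <= sigma)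
    (F : R[i] -> R[i]) (hF : locally_lipschitz F)
    (hFO : bigO_infty F n.-1)
    (e : R -> R * R -> Omega -> \bar R)
    (phi : R -> R -> R * R -> Omega -> R * R)
    (hphi : flow_of_SDE P e phi Ft (drift n F) sigma W1 W2) :
  exists T : R, 0 < T /\
    let E := [set w : Omega | exists z : R * R,
      ereal_sup [set ((phi 0 t z w).1)%:E |
                  t in [set t : R | 0 <= t <= T /\ (t%:E < e 0%R z w)%E]]
        = +oo%E] in
    measurable E /\ P E = 1%E.
Proof.
exists 1; split=> // E.
have [[_ e_gt e_lsc _ phi_cont phi_id _ _] _ phi_max] := hphi.
have [[_ _ W1c _ _] [_ _ W2c _ _] _] := hB.
have aeE : {ae P, forall w, E w}.
  apply: filterS (filterI (filterI W1c W2c) (filterI phi_id phi_max)).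
  move=> w [[cW1 cW2] [id max]].
  apply: (blowup_along_path hn hF hFO ltr01 cW1 cW2 (fun x => e_gt 0 x w (lexx 0))).
  - move=> x t xt; have [V V0x VE] := e_lsc w (0, x) t xt.
    have : within [set p : R * (R * R) | 0 <= p.1] (nbhs ((0 : R), x)) V.
      by rewrite nbhs_subspace_in //=; exact: lexx.
    move=> [[U1 U2] /= [U10 U2x] UV].
    apply: filterS U2x => x' U2x'; apply: (VE (0, x')); apply: (UV (0, x')) => //=.
    by split=> //; exact: nbhs_singleton U10.
  - have cg : continuous (fun q : R * (R * R) => ((0, q.1), q.2) : R * R * (R * R)).
      move=> q U [[V1 V2] /= [[[U1 U2] /= [U10 U2q] UV] V2q] VU].
      exists (U2, V2) => //= -[s x] [/= sU xV]; apply: (VU ((0, s), x)) => /=; split=> //.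
      by apply: (UV (0, s)); split=> //; exact: nbhs_singleton U10.
    apply: (within_continuous_comp cg _ (phi_cont w)) => q [q0 qe].
    by rewrite /= lexx q0.
  - by move=> x; exact: id.
  - by move=> x; exact: max.
have nE : P.-negligible (~` E) by exact: aeE.
(* E is only known to contain a set of full measure; P being complete, this suffices *)
have mE : measurable E.
  by rewrite -[E]setCK; apply: measurableC; exact: filtration_complete hFt _ nE.
have mEC : measurable (~` E) by exact: measurableC.
split=> //; have P0 : P (~` E) = 0%E by apply/negligibleP.
by rewrite -[E]setCK (probability_setC P mEC) P0 sube0.
Qed.
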